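(* Let $\mathcal{B}$ be a $\delta$-share bandwidth allocation game with $n$ players for $0<\delta\le1$, let $\varepsilon>0$, and let $\lambda\in(0,1]$ be such that $u_i^{\mathrm{opt}}\ge\lambda\,u_j^{\mathrm{opt}}$ for all players $i,j$, where $u_i^{\mathrm{opt}}:=\max_{s_i\in\mathcal{S}_i}\sum_{r\in\mathcal{R}}\min(s_i(r),b_r)$. Let $$\alpha_\delta^u := w\cdot\frac{\ln(w)-w+\delta+1}{\delta},\qquad w=-\tfrac12 W_{-1}\left(-2e^{-\delta-2}\right).$$ Then $\mathcal{B}$ reaches an $(\alpha_\delta^u+\varepsilon)$-approximate pure Nash equilibrium in $\mathcal{O}\left(\log(n)\cdot n^5\cdot(\varepsilon\lambda)^{-1}\right)$ $(\alpha_\delta^u+\varepsilon)$-moves.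
   Context: $W_{-1}$ is the lower branch of the Lambert $W$ function (the inverse of $x\mapsto xe^x$ on $(-\infty,-1]$). A bandwidth allocation game (BAG) is a tuple $(\mathcal{N},\mathcal{R},(b_r)_{r\in\mathcal{R}},(\mathcal{S}_i)_{i\in\mathcal{N}})$ with a set of players $\mathcal{N}=\{1,\dots,n\}$, a set of resources $\mathcal{R}=\{r_1,\dots,r_m\}$, a capacity $b_r>0$ for each resource $r$, and for each player $i$ a finite nonempty strategy space $\mathcal{S}_i\subset\mathbb{R}_{\ge 0}^m$. A strategy $s_i=(s_i(r_1),\dots,s_i(r_m))\in\mathcal{S}_i$ has demand $s_i(r)$ on resource $r$. A strategy profile is ${\sf s}=(s_1,\dots,s_n)\in\mathcal{S}=\mathcal{S}_1\times\dots\times\mathcal{S}_n$. The utility of player $i$ from resource $r$ is $u_{i,r}({\sf s})=\min\left(s_i(r),\frac{b_r\, s_i(r)}{\sum_{j\in\mathcal{N}}s_j(r)}\right)$ (equal to $0$ if $s_i(r)=0$), and her total utility is $u_i({\sf s})=\sum_{r\in\mathcal{R}}u_{i,r}({\sf s})$. For $\delta>0$ the game is a $\delta$-share BAG if $s_i(r)\le\delta b_r$ for every player $i$, every $s_i\in\mathcal{S}_i$ and every resource $r$. $({\sf s}_{-i},s_i')$ denotes the profile obtained from ${\sf s}$ by replacing $i$'s strategy with $s_i'$. Let $\alpha\ge1$. An $\alpha$-move is a switch of one player $i$ in a profile ${\sf s}$ from $s_i$ to a strategy $s_i'\in\mathcal{S}_i$ with $\alpha\cdot u_i({\sf s})<u_i({\sf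 s}_{-i},s_i')$. A profile ${\sf s}$ is an $\alpha$-approximate pure Nash equilibrium if $\alpha\cdot u_i({\sf s})\ge u_i({\sf s}_{-i},s_i')$ for all $i\in\mathcal{N}$ and $s_i'\in\mathcal{S}_i$. The game is played by players successively performing such moves, one player at a time, from an initial strategy profile.
   Formalization: Assumes n ≥ 2 (log 1 = 0, yet one player may need a move) and ε ≤ ε₁ for an arbitrary fixed ε₁ on which the O-constant may depend; ''reaches'' means: some run of moves from each start does, and every best-response run obeys the bound (arbitrary runs can be longer). *)

(* Defs.v *)
From HB Require Import structures.
From mathcomp Require Import all_boot all_order all_algebra finmap.
From mathcomp Require Import all_classical all_reals all_analysis.

Set Implicit Arguments.
Unset Strict Implicit.
Unset Printing Implicit Defensive.

Import Order.TTheory GRing.Theory Num.Theory.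

Local Open Scope classical_set_scope.
Local Open Scope ring_scope.

(* Outside the image `[- expR (-1), 0[ of the branch the value is junk. *)
Definition lambertWm1 (R : realType) : R -> R :=
  'pinv_(fun=> -1) [set x : R | x <= -1] (fun x => x * expR x).

Definition alpha_u (R : realType) (delta : R) : R :=
  let w := - (2^-1 * lambertWm1 (- (2 * expR (- delta - 2)))) in
  w * ((ln w - w + delta + 1) / delta).

Record bag (R : realType) (n m : nat) := Bag {
  capacity : 'I_m -> R;
  strategies : 'I_n -> {fset 'rV[R]_m};
  capacity_gt0 : forall r, 0 < capacity r;
  strategies_neq0 : forall i, strategies i != fset0;
  strategies_ge0 : forall i t, t \in strategies i -> forall r, 0 <= t 0 r
}.

Section BandwidthAllocationGame.
Variables (R : realType) (n m : nat) (B : bag R n m).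

Definition delta_share (delta : R) : Prop :=
  forall i t, t \in strategies B i -> forall r, t 0 r <= delta * capacity B r.

(* All demand vectors; [is_profile] singles out the strategy profiles. *)
Definition profile : Type := {ffun 'I_n -> 'rV[R]_m}.

Definition is_profile (s : profile) : Prop :=
  forall i, s i \in strategies B i.

Definition deviate (s : profile) (i : 'I_n) (t : 'rV[R]_m) : profile :=
  [ffun j => if j == i then t else s j].

(* If [s i 0 r = 0] both arguments of the minimum vanish, also when the total
   demand is 0, because [0^-1 = 0]. *)
Definition resource_utility (s : profile) (i : 'I_n) (r : 'I_m) : R :=
  Num.min (s i 0 r) (capacity B r * s i 0 r / \sum_(j < n) s j 0 r).

Definition utility (s : profile) (i : 'I_n) : R :=
  \sum_(r < m) resource_utility s i r.

(* The values are nonnegative and [strategies B i] is nonempty, so starting the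
   maximum at 0 is harmless. *)
Definition opt_utility (i : 'I_n) : R :=
  \big[Num.max/0]_(t <- strategies B i) \sum_(r < m) Num.min (t 0 r) (capacity B r).

Definition approx_nash (alpha : R) (s : profile) : Prop :=
  is_profile s /\
  forall i t, t \in strategies B i ->
    utility (deviate s i t) i <= alpha * utility s i.

Definition best_response (s : profile) (i : 'I_n) (t : 'rV[R]_m) : Prop :=
  t \in strategies B i /\
  forall t', t' \in strategies B i ->
    utility (deviate s i t') i <= utility (deviate s i t) i.

Definition alpha_move (alpha : R) (s s' : profile) : Prop :=
  exists i t, [/\ t \in strategies B i,
    alpha * utility s i < utility (deviate s i t) i & s' = deviate s i t].

Definition best_response_alpha_move (alpha : R) (s s' : profile) : Prop :=
  exists i t, [/\ best_response s i t,
    alpha * utility s i < utility (deviate s i t) i & s' = deviate s i t].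

(* The first [T] steps of the sequence [p] are [step]-moves; the values of [p]
   after time [T] are irrelevant. *)
Definition run (step : profile -> profile -> Prop) (s0 : profile)
    (T : nat) (p : nat -> profile) : Prop :=
  p 0%N = s0 /\ forall k, (k < T)%N -> step (p k) (p k.+1).

End BandwidthAllocationGame.

(* Main.v *)
(* The game has an approximate potential: let every resource [r] with total
   demand [D] contribute [b_r F (D / b_r)], where [F x] is the integral of
   [min 1 (1 / y)] for [y] in [0, x].  If player [i] withdraws from the game, the
   potential drops by an amount lying between [u_i] and [alpha_u delta * u_i]; the
   constant [alpha_u delta] is the maximum over [v] of
   [v (ln v - v + delta + 1) / delta], the worst ratio between the drop and the
   utility on one resource.  Hence an [(alpha_u delta + eps)]-move to a utility [u']
   raises the potential by more than [eps u' / (alpha_u delta + eps)].  After a best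
   response [u'] is at least [1 / n] of the optimal utility of the mover, hence
   at least [lambda / n^2] times the sum of all optimal utilities, which bounds
   the potential from above.  Thus at most [(2 + eps) n^2 / (eps lambda)] best
   response moves are possible, which is within the claimed bound. *)

Require Import Defs.
From mathcomp Require Import all_boot all_order all_algebra finmap.
From mathcomp Require Import all_classical all_reals all_analysis.
From mathcomp Require Import ring lra.
Import Order.TTheory GRing.Theory Num.Theory.
Import numFieldNormedType.Exports.
Set Implicit Arguments.
Unset Strict Implicit.
Unset Printing Implicit Defensive.
Local Open Scope ring_scope.

(** * The constant [alpha_u] and the lower Lambert branch *)

Lemma ln_le_subr1 (R : realType) (x : R) : 0 < x -> ln x <= x - 1.
Proof. by move=> x0; have := @le_ln1Dx R (x - 1); rewrite subrKC; apply; lra. Qed.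

Lemma ln_ge_1Binv (R : realType) (x : R) : 0 < x -> 1 - x^-1 <= ln x.
Proof.
move=> x0; have := @ln_le_subr1 R x^-1; rewrite invr_gt0 lnV ?posrE// => /(_ x0).
lra.
Qed.

(** ['pinv_] selects a preimage inside the set as soon as one exists. *)
Lemma lambertWm1_surj (R : realType) (y : R) :
  (exists2 x, x <= -1 & x * expR x = y) ->
  lambertWm1 y <= -1 /\ lambertWm1 y * expR (lambertWm1 y) = y.
Proof.
move=> [x x1 xy]; set A := [set x : R | x <= -1]%classic.
set f := fun x : R => x * expR x.
have yA : (f @` A)%classic y by exists x.
split; last exact: (@pinvK R R (fun=> -1) A f y (mem_set yA)).
apply: (@surjpinv_image_sub R R (fun=> -1) A (f @` A)%classic f) => //.
by exists y.
Qed.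

(** The equation is the critical-point condition of [v * (ln v - v + delta + 1)]; the sign changes
    between [1] and [1 + delta]. *)
Lemma exists_ln_eq (R : realType) (delta : R) : 0 < delta ->
  exists2 w, 1 <= w & ln w = 2 * w - 2 - delta.
Proof.
move=> d0; pose f (x : R) := ln x - (2 * x - 2 - delta).
have f1 : 0 <= f 1 by rewrite /f ln1; lra.
have fd : f (1 + delta) <= 0.
  by have := @ln_le_subr1 R (1 + delta); rewrite /f => H; have : 0 < 1 + delta; lra.
have [|||w] := @IVT R f 1 (1 + delta) 0; first lra.
- apply: continuous_in_subspaceT => x; rewrite inE /= in_itv /= => /andP[x1 _].
  apply: cvgB; first by apply: continuous_ln; lra.
  apply: cvgB; last exact: cvg_cst.
  apply: cvgB; last exact: cvg_cst.
  by apply: cvgM; [exact: cvg_cst|exact: cvg_id].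
- by rewrite ge_min fd orbT le_max f1.
by rewrite in_itv /= => /andP[w1 _] fw; exists w => //; move: fw; rewrite /f; lra.
Qed.

Lemma alpha_u_w (R : realType) (delta : R) : 0 < delta ->
  exists w : R, [/\ 1 <= w, ln w = 2 * w - 2 - delta &
    alpha_u delta * delta = w ^+ 2 - w].
Proof.
move=> d0; rewrite /alpha_u; set W := lambertWm1 _.
have [|W1 WE] := @lambertWm1_surj R (- (2 * expR (- delta - 2))).
  (* Exponentiating the equation for [w] shows that [- (2 * w)] is a preimage. *)
  have [w w1 lnw] := exists_ln_eq d0; exists (- (2 * w)); first lra.
  rewrite -[w in - (2 * w) * _](@lnK R) ?posrE ?(lt_le_trans ltr01)//.
  by rewrite mulNr -mulrA -expRD lnw; congr (- (2 * expR _)); lra.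
rewrite -/W in W1 WE; cbv zeta; set w := - (2^-1 * W).
have WwE : W = - (2 * w) by rewrite /w; lra.
have w2 : 2^-1 <= w by rewrite /w; lra.
have w0 : 0 < w by lra.
have lnw : ln w = 2 * w - 2 - delta.
  suff {1}-> : w = expR (2 * w - 2 - delta) by rewrite expRK.
  rewrite (_ : 2 * w - 2 - delta = 2 * w + (- delta - 2)); last by ring.
  rewrite expRD -[expR (- delta - 2)](mulKf (_ : 2 != 0)) ?pnatr_eq0//.
  move: WE; rewrite WwE expRN mulNr => /oppr_inj <-.
  by have := expR_gt0 (2 * w) => e0; field; rewrite gt_eqF.
(* The branch itself only gives [2^-1 <= w]. If [w < 1], then [1 - w^-1 <= ln w] would yield
   [delta <= (w - 1) * (2 - w^-1) <= 0]. *)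
have w1 : 1 <= w.
  rewrite leNgt; apply/negP => w1.
  have : 1 - w^-1 <= ln w by exact: ln_ge_1Binv.
  have wV : w^-1 * w = 1 by rewrite mulVf ?gt_eqF.
  have : w^-1 <= 2 by rewrite invf_ple ?posrE.
  rewrite lnw; nra.
by exists w; split => //; rewrite lnw; field; rewrite gt_eqF.
Qed.

(* At the critical point [w] one has [alpha_u delta * delta = w^2 - w], and
   [ln (v / w) <= v / w - 1] reduces the claim to [(v / w - 1)^2 w (w - 1) >= 0]. *)
Lemma alpha_u_max (R : realType) (delta v : R) : 0 < delta -> 0 < v ->
  v * (ln v - v + delta + 1) <= alpha_u delta * delta.
Proof.
move=> d0 v0; have [w [w1 lnw ->]] := alpha_u_w d0.
have w0 : 0 < w by lra.
have vw0 : 0 < v / w by rewrite divr_gt0.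
have : ln (v / w) <= v / w - 1 by exact: ln_le_subr1.
rewrite ln_div ?posrE// lnw => H.
have vwE : v / w * w = v by rewrite divfK ?gt_eqF.
set q := v / w in H vwE *; rewrite -vwE in v0 H *.
have : q * w * (ln (q * w)) <= q * w * (q - 1 + (2 * w - 2 - delta)).
  by rewrite ler_pM2l//; lra.
have : 0 <= (q - 1) ^+ 2 * (w * (w - 1)).
  by rewrite mulr_ge0 ?sqr_ge0// mulr_ge0 ?subr_ge0// ltW.
nra.
Qed.

(** The lower bound is the value at [v = 1]; for the upper one, [ln w <= w - 1] forces
    [w <= 1 + delta]. *)
Lemma alpha_u_bounds (R : realType) (delta : R) : 0 < delta ->
  1 <= alpha_u delta <= 1 + delta.
Proof.
move=> d0; have := @alpha_u_max R delta 1 d0; rewrite ln1 => /(_ ltr01) a1.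
apply/andP; split; first by rewrite -(ler_pM2r d0); lra.
have [w [w1 lnw aE]] := alpha_u_w d0.
have w0 : 0 < w by lra.
have := ln_le_subr1 w0; rewrite lnw => H.
rewrite -(ler_pM2r d0) aE; nra.
Qed.

(** * Potential increments on a single resource *)

(* The antiderivative of the bandwidth share [min 1 (1 / x)]. *)
Definition share_potential (R : realType) (x : R) : R :=
  Num.min x 1 + ln (Num.max x 1).

Lemma share_potential_ge0 (R : realType) (x : R) : 0 <= x ->
  0 <= share_potential x.
Proof.
by move=> x0; rewrite addr_ge0 ?le_min ?x0 ?ler01// ln_ge0// le_max lexx orbT.
Qed.

Lemma share_potential_le (R : realType) (x : R) : share_potential x <= x.
Proof.
rewrite /share_potential; case: (leP x 1) => x1; first by rewrite ln1 addr0.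
by have := @ln_le_subr1 R x; lra.
Qed.

(** The integrand [min 1 (1 / t)] is nonincreasing, so its integral over [[y, x + y]] is at least
    [x] times its value at the right end. *)
Lemma share_potential_increment_ge (R : realType) (x y : R) : 0 <= x -> 0 <= y ->
  Num.min x (x / (x + y)) <= share_potential (x + y) - share_potential y.
Proof.
move=> x0 y0; rewrite /share_potential.
case: (leP (x + y) 1) => D1.
  by case: (leP y 1) => y1; [rewrite ln1 ge_min; apply/orP; left; lra|lra].
rewrite ge_min; apply/orP; right.
have D0 : 0 < x + y by lra.
have -> : x / (x + y) = 1 - y / (x + y) by field; rewrite gt_eqF.
case: (leP y 1) => y1.
  rewrite ln1 addr0.
  have := ln_ge_1Binv D0.
  have : 0 <= (1 - y) * (1 - (x + y)^-1).
    by rewrite mulr_ge0 ?subr_ge0// invf_le1// ltW.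
  lra.
have y0' : 0 < y by lra.
have /ln_ge_1Binv : 0 < (x + y) / y by rewrite divr_gt0.
by rewrite ln_div ?posrE// invf_div; lra.
Qed.

Lemma share_potential_increment_le (R : realType) (delta x y : R) :
  0 < delta -> 0 <= x <= delta -> 0 <= y ->
  share_potential (x + y) - share_potential y
    <= alpha_u delta * Num.min x (x / (x + y)).
Proof.
move=> d0 /andP[x0 xd] y0.
have /andP[a1 _] := alpha_u_bounds d0.
(* The claim is affine in [u]: at [u = 0] it follows from [ln v <= v - 1], at [u = delta] it is
   [alpha_u_max]. *)
have key v u : 0 < v -> 0 <= u <= delta ->
    v * (1 + ln v - v + u) <= alpha_u delta * u.
  move=> v0 /andP[u0 ud]; have lnv := ln_le_subr1 v0.
  have am := alpha_u_max d0 v0.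
  have q0 : v * (1 + ln v - v) <= 0 by rewrite pmulr_rle0//; lra.
  rewrite -(ler_pM2r d0).
  have : 0 <= (- (v * (1 + ln v - v))) * (delta - u) by rewrite mulr_ge0; lra.
  have : 0 <= (alpha_u delta * delta - v * (ln v - v + delta + 1)) * u.
    by rewrite mulr_ge0 ?subr_ge0.
  nra.
rewrite /share_potential; case: (leP (x + y) 1) => D1.
  rewrite ln1; have /min_idPl -> : x <= x / (x + y).
    have [->|x0'] := eqVneq x 0; first by rewrite mul0r.
    have D0 : 0 < x + y by rewrite ltr_wpDr// lt0r x0'.
    by rewrite ler_pdivlMr// ler_piMr.
  by case: (leP y 1) => y1; [rewrite ln1; nra|lra].
have D0 : 0 < x + y by lra.
have /min_idPr -> : x / (x + y) <= x by rewrite ler_pdivrMr// ler_peMr// ltW.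
rewrite mulrA ler_pdivlMr// mulrC.
case: (leP y 1) => y1.
  by rewrite ln1 addr0; have := @key _ x D0; rewrite x0 xd => /(_ isT); nra.
have y0' : 0 < y by lra.
(* Here [key] is applied with [u = x / y], so that [v - u = 1] and only [v * ln v] remains. *)
have v0 : 0 < (x + y) / y by rewrite divr_gt0.
have : 0 <= x / y <= delta.
  by rewrite divr_ge0// (le_trans _ xd)// ler_pdivrMr// ler_peMr// ltW.
move=> /(key _ _ v0); rewrite ln_div ?posrE// -(ler_pM2r y0').
by congr (_ <= _); field; rewrite gt_eqF.
Qed.

(** * Potential and utilities of the whole game *)

Section Game.
Variables (R : realType) (n m : nat) (B : bag R n m).
Implicit Types (s : profile R n m) (i : 'I_n) (r : 'I_m).

Definition load s r : R := \sum_(j < n) s j 0 r.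

Definition others_load s i r : R := \sum_(j < n | j != i) s j 0 r.

Definition potential s : R :=
  \sum_(r < m) capacity B r * share_potential (load s r / capacity B r).

(** The potential after player [i] withdraws: a common reference for the profiles before and after
    her move. *)
Definition others_potential s i : R :=
  \sum_(r < m) capacity B r * share_potential (others_load s i r / capacity B r).

Lemma loadE s i r : load s r = s i 0 r + others_load s i r.
Proof. by rewrite /load (bigD1 i). Qed.

Lemma others_load_deviate s i t r :
  others_load (deviate s i t) i r = others_load s i r.
Proof. by apply: eq_bigr => j /negPf ji; rewrite ffunE ji. Qed.

Lemma others_potential_deviate s i t :
  others_potential (deviate s i t) i = others_potential s i.
Proof. by apply: eq_bigr => r _; rewrite others_load_deviate. Qed.

Lemma is_profile_deviate s i t : is_profile B s -> t \in strategies B i ->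
  is_profile B (deviate s i t).
Proof. by move=> sP tS j; rewrite ffunE; case: eqP => [->|_]. Qed.

Lemma profile_ge0 s i r : is_profile B s -> 0 <= s i 0 r.
Proof. by move=> sP; exact: (strategies_ge0 (sP i)). Qed.

Lemma others_load_ge0 s i r : is_profile B s -> 0 <= others_load s i r.
Proof. by move=> sP; apply: sumr_ge0 => j _; exact: profile_ge0. Qed.

(** Dividing all demands by the capacity reduces each resource to the one-variable estimates. *)
Lemma resource_utilityE s i r (b := capacity B r) :
  resource_utility B s i r =
  b * Num.min (s i 0 r / b) (s i 0 r / b / (s i 0 r / b + others_load s i r / b)).
Proof.
have b0 : 0 < b := capacity_gt0 B r.
rewrite /resource_utility -/(load s r) (loadE s i) minr_pMr ?ltW//.
rewrite -mulrDl [b * (s i 0 r / b)]mulrC divfK ?gt_eqF// invfM invrK.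
congr Num.min; rewrite -/b; set D := (_ + _)^-1; by field; rewrite gt_eqF.
Qed.

Lemma utility_ge0 s i : is_profile B s -> 0 <= utility B s i.
Proof.
move=> sP; apply: sumr_ge0 => r _; have s0 := profile_ge0 i r sP.
rewrite le_min s0 divr_ge0 ?mulr_ge0 ?(ltW (capacity_gt0 B r))//.
by apply: sumr_ge0 => j _; exact: profile_ge0.
Qed.

Lemma utility_le_potential s i : is_profile B s ->
  utility B s i <= potential s - others_potential s i.
Proof.
move=> sP; rewrite -sumrB; apply: ler_sum => r _.
have b0 := capacity_gt0 B r.
rewrite resource_utilityE (loadE s i) -mulrBr ler_pM2l// [(_ + _) / _]mulrDl.
by apply: share_potential_increment_ge; rewrite divr_ge0 ?(ltW b0)//;
  [exact: profile_ge0|exact: others_load_ge0].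
Qed.

Lemma potential_le_utility delta s i : 0 < delta -> delta_share B delta ->
  is_profile B s ->
  potential s - others_potential s i <= alpha_u delta * utility B s i.
Proof.
move=> d0 dB sP; rewrite -sumrB mulr_sumr; apply: ler_sum => r _.
have b0 := capacity_gt0 B r.
rewrite resource_utilityE (loadE s i) -mulrBr mulrCA ler_pM2l// [(_ + _) / _]mulrDl.
apply: share_potential_increment_le => //.
  by rewrite divr_ge0 ?(ltW b0) ?profile_ge0//= ler_pdivrMr//; exact: dB (sP i) r.
by rewrite divr_ge0 ?(ltW b0)// others_load_ge0.
Qed.

Lemma potential_ge0 s : is_profile B s -> 0 <= potential s.
Proof.
move=> sP; apply: sumr_ge0 => r _; have b0 := ltW (capacity_gt0 B r).
rewrite mulr_ge0// share_potential_ge0// divr_ge0//.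
by apply: sumr_ge0 => j _; exact: profile_ge0.
Qed.

Lemma opt_utility_ge0 i : 0 <= opt_utility B i.
Proof. exact: bigmax_ge_id. Qed.

(** The potential is at most the total demand, and since [delta <= 1] no single demand is truncated
    by the capacity. *)
Lemma potential_le_opt delta s : delta <= 1 -> delta_share B delta ->
  is_profile B s -> potential s <= \sum_i opt_utility B i.
Proof.
move=> d1 dB sP; apply: (@le_trans _ _ (\sum_(r < m) load s r)).
  apply: ler_sum => r _; have b0 := capacity_gt0 B r.
  by rewrite mulrC -ler_pdivlMr// share_potential_le.
rewrite exchange_big; apply: ler_sum => i _.
suff -> : \sum_(r < m) s i 0 r = \sum_(r < m) Num.min (s i 0 r) (capacity B r).
  by apply: (@le_bigmax_seq _ _ _ _ _ (s i)) => //; exact: sP.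
apply: eq_bigr => r _; apply/esym/min_idPl.
by rewrite (le_trans (dB _ _ (sP i) r))// ler_piMl// ltW// capacity_gt0.
Qed.

(* On each resource the total demand is at most [n] times the capacity, so a
   player always receives at least a fraction [1 / n] of what she could use. *)
Lemma opt_le_best_response delta s i t : delta <= 1 -> delta_share B delta ->
  is_profile B s -> best_response B s i t ->
  opt_utility B i <= n%:R * utility B (deviate s i t) i.
Proof.
move=> d1 dB sP [tS tbest].
have dP q : q \in strategies B i -> is_profile B (deviate s i q).
  exact: is_profile_deviate.
rewrite /opt_utility big_seq; apply: bigmax_le => [|q qS].
  by rewrite mulr_ge0// utility_ge0//; exact: dP.
apply: (@le_trans _ _ (n%:R * utility B (deviate s i q) i)); last first.
  by rewrite ler_wpM2l// tbest.
rewrite mulr_sumr; apply: ler_sum => r _; have b0 := capacity_gt0 B r.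
rewrite /resource_utility -/(load (deviate s i q) r).
have lb p j : is_profile B p -> p j 0 r <= capacity B r.
  by move=> pP; rewrite (le_trans (dB _ _ (pP j) r))// ler_piMl// ltW.
have Dn : load (deviate s i q) r <= n%:R * capacity B r.
  have -> : n%:R * capacity B r = \sum_(j < n) capacity B r.
    by rewrite sumr_const card_ord mulr_natl.
  apply: ler_sum => j _.
  by apply: lb; exact: dP.
have := loadE (deviate s i q) i r; have := others_load_ge0 i r (dP _ qS).
have := profile_ge0 i r (dP _ qS).
rewrite {1 2}ffunE eqxx; set x := q 0 r => x0 o0 DE.
rewrite ffunE eqxx -/x minr_pMr// ge_min; apply/orP; left.
rewrite le_min; apply/andP; split.
  by rewrite ler_peMl// ler1n (leq_trans _ (ltn_ord i)).
have [->|xn0] := eqVneq x 0; first by rewrite mulr0 mul0r mulr0.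
have D0 : 0 < load (deviate s i q) r by rewrite DE ltr_wpDr// lt0r xn0.
by rewrite mulrA ler_pdivlMr// mulrA [x * _]mulrC ler_wpM2r.
Qed.

(** * Counting best-response moves *)

(** Withdrawing costs at most [alpha_u delta * u] and re-entering gains at least [u']; the move
    condition then bounds [u] by [u' / (alpha_u delta + eps)]. *)
Lemma potential_gain delta eps s i t : 0 < delta -> delta_share B delta ->
  0 < eps -> is_profile B s -> t \in strategies B i ->
  (alpha_u delta + eps) * utility B s i < utility B (deviate s i t) i ->
  eps * utility B (deviate s i t) i
    < (alpha_u delta + eps) * (potential (deviate s i t) - potential s).
Proof.
move=> d0 dB e0 sP tS mv; have /andP[a1 _] := alpha_u_bounds d0.
have := potential_le_utility i d0 dB sP.
have := utility_le_potential i (is_profile_deviate sP tS).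
rewrite others_potential_deviate; set a := alpha_u delta in a1 mv *.
set u := utility _ s i in mv *; set u' := utility _ _ i in mv *.
move=> H1 H2.
have : 0 < a * (u' - (a + eps) * u) by rewrite mulr_gt0 ?subr_gt0//; lra.
have : 0 <= (a + eps) * (potential (deviate s i t) - potential s - u' + a * u).
  by rewrite mulr_ge0//; lra.
nra.
Qed.

Lemma best_response_gain delta eps eps1 lambda s s' : 0 < delta <= 1 ->
  delta_share B delta -> 0 < eps <= eps1 -> 0 < lambda ->
  (forall i j, lambda * opt_utility B j <= opt_utility B i) ->
  is_profile B s -> best_response_alpha_move B (alpha_u delta + eps) s s' ->
  is_profile B s' /\
  eps * lambda * \sum_i opt_utility B i
    < (2 + eps1) * n%:R ^+ 2 * (potential s' - potential s).
Proof.
move=> /andP[d0 d1] dB /andP[e0 e1] l0 opt sP [i [t [br mv ->]]].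
have tS : t \in strategies B i by case: br.
have sP' := is_profile_deviate sP tS; split => //.
have /andP[a1 a2] := alpha_u_bounds d0.
have gain := potential_gain d0 dB e0 sP tS mv.
have ou := opt_le_best_response d1 dB sP br.
have u0 := utility_ge0 i sP'.
set u := utility _ _ _ in gain ou u0; set g := _ - _ in gain *.
have n0 : 0 < n%:R :> R by rewrite ltr0n (leq_trans _ (ltn_ord i)).
have lu : lambda * \sum_j opt_utility B j <= n%:R ^+ 2 * u.
  rewrite mulr_sumr expr2 -mulrA (le_trans (ler_sum _ (fun j _ => opt i j)))//.
  by rewrite sumr_const card_ord -[leLHS]mulr_natl ler_wpM2l.
(* Positivity of the gain allows [alpha_u delta + eps] to be replaced by the larger [2 + eps1]. *)
have g0 : 0 < g.
  by rewrite -(pmulr_rgt0 _ (_ : 0 < alpha_u delta + eps)); [nra|lra].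
rewrite -mulrA (le_lt_trans (ler_wpM2l (ltW e0) lu))//.
rewrite mulrCA -mulrA [ltRHS]mulrCA ltr_pM2l ?exprn_gt0//.
by rewrite (lt_le_trans gain)// ler_wpM2r ?(ltW g0)//; lra.
Qed.

Lemma best_response_run_bound delta eps eps1 lambda s0 T p :
  0 < delta <= 1 -> delta_share B delta -> 0 < eps <= eps1 -> 0 < lambda ->
  (forall i j, lambda * opt_utility B j <= opt_utility B i) ->
  is_profile B s0 ->
  run (best_response_alpha_move B (alpha_u delta + eps)) s0 T p ->
  is_profile B (p T) /\ T%:R * (eps * lambda) <= (2 + eps1) * n%:R ^+ 2.
Proof.
move=> d01 dB e01 l0 opt s0P [p0 pstep].
have step k kT sP := best_response_gain d01 dB e01 l0 opt sP (pstep k kT).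
have [e0 e1] := andP e01; have [d0 d1] := andP d01.
set O := \sum_i _ in step; set A := (2 + eps1) * _ in step *.
have A0 : 0 <= A by rewrite mulr_ge0 ?exprn_ge0//; lra.
have bound k : (k <= T)%N -> is_profile B (p k) /\
    k%:R * (eps * lambda * O) <= A * (potential (p k) - potential s0).
  elim: k => [_|k IH kT]; first by rewrite p0 subrr mulr0 mul0r.
  have [pP le_pk] := IH (ltnW kT); have [pP' lt_pk] := step k kT pP.
  by split=> //; rewrite -natr1; lra.
split; first by case: (bound T).
(* The last step is kept strict so that [O] can be cancelled even when it might vanish. *)
case: T pstep step bound => [|T] _ step bound; first by rewrite mul0r.
have [pP le_pT] := bound T (leqnSn T); have [pP' lt_pT] := step T (ltnSn T) pP.
have : T.+1%:R * (eps * lambda * O) < A * (potential (p T.+1) - potential s0).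
  by rewrite -natr1; lra.
have := potential_le_opt d1 dB pP'; rewrite -/O => PO.
have : A * (potential (p T.+1) - potential s0) <= A * O.
  by rewrite ler_wpM2l//; have := potential_ge0 s0P; lra.
move=> H1 H2; have := lt_le_trans H2 H1; rewrite mulrA leNgt => H3.
apply/negP => H4; move: H3; apply/negP; rewrite -leNgt ler_wpM2r ?(ltW H4)//.
by apply: sumr_ge0 => i _; exact: opt_utility_ge0.
Qed.

(** * Reaching an approximate equilibrium *)

Lemma exists_best_response s i : exists t, best_response B s i t.
Proof.
have /fset0Pn[t0 t0S] := strategies_neq0 B i.
pose f (x : strategies B i) := utility B (deviate s i (val x)) i.
exists (val [arg max_(x > [` t0S]%fset) f x]%O); split; first exact: valP.
by move=> t tS; case: arg_maxP => // x _ /(_ [` tS]%fset isT).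
Qed.

Lemma best_response_moveW alpha s s' :
  best_response_alpha_move B alpha s s' -> alpha_move B alpha s s'.
Proof. by move=> [i [t [[tS _] mv ->]]]; exists i, t. Qed.

Lemma approx_nashPn alpha s : is_profile B s -> ~ approx_nash B alpha s ->
  exists s', best_response_alpha_move B alpha s s'.
Proof.
move=> sP nN; apply: contrapT => nm; apply: nN; split=> // i t tS.
rewrite leNgt; apply/negP => lt_t; apply: nm.
have [t' [tS' best]] := exists_best_response s i.
by exists (deviate s i t'), i, t'; split => //; exact: lt_le_trans lt_t (best _ tS).
Qed.

Lemma run_extend (step : profile R n m -> profile R n m -> Prop) s0 T p s :
  run step s0 T p -> step (p T) s -> exists q, run step s0 T.+1 q.
Proof.
move=> [p0 pstep] st; exists (fun k => if (k <= T)%N then p k else s).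
split=> // k; rewrite ltnS leq_eqVlt => /predU1P[->|kT] /=.
  by rewrite eqxx ltnn.
by rewrite kT orbT; exact: pstep.
Qed.

(** If no run ended in an equilibrium, every run could be prolonged, giving one of length [N.+1]. *)
Lemma approx_nash_reached alpha s0 (N : nat) :
  (forall T p, run (best_response_alpha_move B alpha) s0 T p ->
     is_profile B (p T) /\ (T <= N)%N) ->
  exists T p, run (best_response_alpha_move B alpha) s0 T p /\
    approx_nash B alpha (p T).
Proof.
move=> bound; apply: contrapT => nex.
suff /(_ N.+1)[p /bound[_]] :
    forall T, exists p, run (best_response_alpha_move B alpha) s0 T p.
  by rewrite ltnn.
elim=> [|T [p pr]]; first by exists (fun=> s0).
have [pP _] := bound _ _ pr.
have [|s st] := @approx_nashPn alpha (p T) pP; last exact: run_extend pr st.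
by move=> pN; apply: nex; exists T, p.
Qed.

End Game.

(* The O-constant C is absolute, apart from the upper end [eps1] of the range
   of epsilon: it does not depend on n, on the game, on delta, epsilon or
   lambda. *)
Theorem theorem4p8 (R : realType) (eps1 : R) :
  exists2 C : R, 0 < C &
  forall (n m : nat) (B : bag R n m) (delta eps lambda : R),
    (2 <= n)%N ->
    0 < delta <= 1 ->
    delta_share B delta ->
    0 < eps <= eps1 ->
    0 < lambda <= 1 ->
    (forall i j, lambda * opt_utility B j <= opt_utility B i) ->
    let alpha := alpha_u delta + eps in
    let K := C * (ln n%:R * n%:R ^+ 5 * (eps * lambda)^-1) in
    forall s0 : profile R n m, is_profile B s0 ->
      (exists T p, [/\ run (alpha_move B alpha) s0 T p,
         approx_nash B alpha (p T) & T%:R <= K]) /\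
      (forall T p, run (best_response_alpha_move B alpha) s0 T p -> T%:R <= K).

Proof.
have ln2 : 0 < ln 2 :> R by rewrite ln_gt0// ltr1n.
(* Dividing by [ln 2] absorbs the logarithm, as [ln 2 <= ln n] for [n >= 2]; the absolute value
   keeps the constant positive for every [eps1]. *)
exists ((2 + `|eps1|) / ln 2); first by rewrite divr_gt0// ltr_wpDr.
move=> n m B delta eps lambda n2 d01 dB e01 l01 opt alpha K s0 s0P.
have [l0 _] := andP l01; have [e0 e1] := andP e01.
have el0 : 0 < eps * lambda by rewrite mulr_gt0.
have n1 : 1 <= n%:R :> R by rewrite ler1n ltnW.
have bound T p : run (best_response_alpha_move B alpha) s0 T p ->
    is_profile B (p T) /\ T%:R <= K.
  move=> /(best_response_run_bound d01 dB e01 l0 opt s0P)[pP TA]; split=> //.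
  rewrite /K [leRHS]mulrA ler_pdivlMr// (le_trans TA)// [leRHS]mulrA.
  apply: ler_pM; [lra|exact: exprn_ge0| |exact: ler_weXn2l].
  rewrite mulrAC ler_pdivlMr//; apply: ler_pM; [lra|exact: ltW| |].
    by rewrite lerD2l ler_norm.
  by rewrite ler_ln ?posrE ?ltr0n ?ler_nat// (ltn_trans _ n2).
split; last by move=> T p /bound[].
have [|T [p [pr pN]]] := @approx_nash_reached R n m B alpha s0 (Num.truncn K).
  by move=> T p /bound[pP TK]; split=> //; rewrite truncn_ge_nat// (le_trans _ TK).
have [_ TK] := bound _ _ pr; exists T, p; split=> //.
by case: pr => p0 step; split=> // k /step; exact: best_response_moveW.
Qed.
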